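(* Let $V$ be a finite set and let $\mathcal{C}$ be a minimal set cover of $V$. From each set $C\in\mathcal{C}$ choose one loyal vertex of $C$ (an element of $V$ lying in $C$ and in no other member of $\mathcal{C}$). Let $S$ be the set of chosen vertices and $K=V\setminus S$. Let $G$ be the graph with vertex set $V$ in which distinct $u,v$ are adjacent if and only if either $u$ and $v$ lie together in some member of $\mathcal{C}$, or $u,v\in K$. Then $G$ is a split graph, and $G$ is an unbalanced split graph if and only if $\mathcal{C}$ is an unbalanced minimal set cover (equivalently, $G$ is balanced if and only if $\mathcal{C}$ is balanced).
   Context: A set cover of a finite set $V$ is a collection $\mathcal{C}$ of subsets of $V$ whose union is $V$; it is minimal if no member of $\mathcal{C}$ is contained in the union of the remaining members. A minimal set cover $\mathcal{C}$ of $V$ is unbalanced if it contains a set of cardinality $|V|-|\mathcal{C}|+1$, and balanced otherwise. A finite graph $G$ is a split graph if its vertex set can be partitioned as $K\cup S$ with $K$ a clique and $S$ a stable set (a $KS$-partition). Writing $\omega(G)$ for the clique number and $\alpha(G)$ for the independence number, a split graph is balanced if it has a $KS$-partition with $|K|=\omega(G)$ and $|S|=\alpha(G)$, and unbalanced otherwise. *)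

(* Defs.v *)
From mathcomp Require Import all_boot.

Set Implicit Arguments.
Unset Strict Implicit.
Unset Printing Implicit Defensive.

Section SetCovers.

Variable V : finType.
Implicit Types (C : {set {set V}}) (A : {set V}) (x : V).

Definition is_set_cover C : Prop := cover C = [set: V].

Definition minimal_set_cover C : Prop :=
  is_set_cover C /\ forall A, A \in C -> ~~ (A \subset cover (C :\ A)).

(* The subtraction does not truncate: members of a minimal set cover have
   distinct loyal elements, so #|C| <= #|V|. *)
Definition has_unbalancing_set C : Prop :=
  exists2 A, A \in C & #|A| = #|V| - #|C| + 1.

Definition unbalanced_cover C : Prop :=
  minimal_set_cover C /\ has_unbalancing_set C.

Definition balanced_cover C : Prop :=
  minimal_set_cover C /\ ~ has_unbalancing_set C.

Definition loyal C A x : Prop :=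
  x \in A /\ forall B, B \in C -> B != A -> x \notin B.

End SetCovers.

Record sgraph (V : finType) := SGraph {
  adj :> rel V;
  adj_sym : symmetric adj;
  adj_irr : irreflexive adj
}.

Section SplitGraphs.

Variables (V : finType) (G : sgraph V).
Implicit Types (K S : {set V}).

Definition clique K : bool :=
  [forall u in K, forall v in K, (u != v) ==> G u v].

Definition stable S : bool :=
  [forall u in S, forall v in S, ~~ G u v].

Definition clique_number : nat := \max_(K : {set V} | clique K) #|K|.

Definition independence_number : nat := \max_(S : {set V} | stable S) #|S|.

(* The parts may be empty. *)
Definition KS_partition K S : Prop :=
  [/\ K :|: S = [set: V], [disjoint K & S], clique K & stable S].

Definition split_graph : Prop := exists K S, KS_partition K S.

Definition has_balanced_KS_partition : Prop :=
  exists K S, [/\ KS_partition K S, #|K| = clique_number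
                & #|S| = independence_number].

Definition balanced_split_graph : Prop :=
  split_graph /\ has_balanced_KS_partition.

Definition unbalanced_split_graph : Prop :=
  split_graph /\ ~ has_balanced_KS_partition.

End SplitGraphs.

Section CoverGraph.

Variables (V : finType) (C : {set {set V}}) (K : {set V}).

Definition cover_adj : rel V := fun u v =>
  (u != v) &&
  ([exists A in C, (u \in A) && (v \in A)] || (u \in K) && (v \in K)).

Lemma cover_adj_sym : symmetric cover_adj.
Proof.
move=> u v; rewrite /cover_adj eq_sym [(u \in K) && _]andbC; congr (_ && (_ || _)).
by apply: eq_existsb => A; rewrite [(u \in A) && _]andbC.
Qed.

Lemma cover_adj_irr : irreflexive cover_adj.
Proof. by move=> u; rewrite /cover_adj eqxx. Qed.

Definition cover_graph : sgraph V := SGraph cover_adj_sym cover_adj_irr.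

End CoverGraph.

(* Main.v *)
Require Import Defs.
From mathcomp Require Import all_boot.

Set Implicit Arguments.
Unset Strict Implicit.
Unset Printing Implicit Defensive.

(** Each member of [C] is a clique of [G], so a stable set meets it at most
    once; hence [alpha(G) = #|C| = #|S|], and a balanced KS-partition exists
    exactly when [omega(G) = #|K|].  The neighbours of the chosen vertex of [A]
    are the other elements of [A], so a clique lies in [K] or in a member of
    [C]; and [A] meets [S] only in its chosen vertex, so [#|A| <= #|K| + 1].
    Thus [omega(G) > #|K|] exactly when some member of [C] has
    [#|K| + 1 = #|V| - #|C| + 1] elements. *)

Lemma clique_leq_number (V : finType) (G : sgraph V) (Q : {set V}) :
  clique G Q -> #|Q| <= clique_number G.
Proof. by move=> cQ; apply: (@leq_bigmax_cond _ _ (fun Q : {set V} => #|Q|)). Qed.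

Lemma KS_partition_card (V : finType) (G : sgraph V) (K S : {set V}) :
  KS_partition G K S -> #|K| + #|S| = #|V|.
Proof.
by case=> KS_V dKS _ _; rewrite -cardsUI KS_V cardsT disjoint_setI0 // cards0 addn0.
Qed.

Section CoverGraphTheory.

Variables (V : finType) (C : {set {set V}}) (s : {A : {set V} | A \in C} -> V).
Hypothesis coverC : is_set_cover C.
Hypothesis loyal_s : forall A, loyal C (val A) (s A).

Local Notation S := [set s A | A : {A : {set V} | A \in C}].
Local Notation K := (~: S).
Local Notation G := (cover_graph C K).

Lemma mem_loyal A B : B \in C -> s A \in B -> B = val A.
Proof.
move=> BC sAB; apply/eqP; apply: contraTT sAB => neqBA.
by have [_] := loyal_s A; apply.
Qed.

Lemma loyal_choice_inj : injective s.
Proof.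
move=> A B sAB; apply/esym/val_inj/mem_loyal; first exact: valP.
by rewrite sAB; case: (loyal_s B).
Qed.

Lemma card_loyal_choice : #|S| = #|C|.
Proof. by rewrite card_imset ?card_sig //; apply: loyal_choice_inj. Qed.

(** Reads the size [#|V| - #|C| + 1] of an unbalancing set as [#|K| + 1]. *)
Lemma card_disloyal : #|K| = #|V| - #|C|.
Proof. by rewrite cardsCs setCK card_loyal_choice. Qed.

Lemma cover_mem_clique A : A \in C -> clique G A.
Proof.
move=> AC; apply/forall_inP => u uA; apply/forall_inP => v vA; apply/implyP => neq_uv.
by rewrite /= /cover_adj neq_uv; apply/orP; left; apply/exists_inP; exists A; rewrite ?uA.
Qed.

(** The vertex [s A] is outside [K] and in no member of [C] but [A], so an edge at [s A] can only
    come from [A]. *)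
Lemma loyal_neighbour A v : G (s A) v -> v \in val A.
Proof.
rewrite /= /cover_adj => /andP[_ /orP[/exists_inP[B BC /andP[sAB vB]]|]].
  by rewrite -(mem_loyal BC sAB).
by rewrite inE imset_f.
Qed.

Lemma cover_KS_partition : KS_partition G K S.
Proof.
split; first by rewrite setUC setUCr.
- by rewrite disjoints_subset.
- apply/forall_inP => u uK; apply/forall_inP => v vK; apply/implyP => neq_uv.
  by rewrite /= /cover_adj neq_uv uK vK orbT.
apply/forall_inP => _ /imsetP[A _ ->]; apply/forall_inP => _ /imsetP[B _ ->].
apply/negP => sAsB; have /(mem_loyal (valP A))/val_inj eqAB := loyal_neighbour sAsB.
by move: sAsB; rewrite eqAB adj_irr.
Qed.

Lemma stable_card_leq (I : {set V}) : stable G I -> #|I| <= #|C|.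
Proof.
(* Here [pblock] merely picks some member of [C] containing [v]; [C] need not be a partition. *)
move=> /forall_inP stI; pose f v := pblock C v.
have memC v : v \in cover C by rewrite coverC inE.
have fC v : f v \in C by apply: pblock_mem.
have fv v : v \in f v by rewrite mem_pblock.
have injf : {in I &, injective f}.
  (* Distinct [u] and [v] with the same image would be adjacent, as both lie in the clique [f u]. *)
  move=> u v uI vI fuv; apply/eqP; apply: contraTT (forall_inP (stI u uI) v vI).
  move=> neq_uv; rewrite negbK; have /forall_inP clu := cover_mem_clique (fC u).
  by have /forall_inP/(_ v) := clu u (fv u); rewrite neq_uv fuv fv; apply.
rewrite -(card_in_imset injf); apply/subset_leq_card/subsetP => _ /imsetP[v _ ->].
exact: fC.
Qed.

Lemma cover_independence_number : independence_number G = #|C|.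
Proof.
apply/eqP; rewrite eqn_leq; apply/andP; split.
  by apply/bigmax_leqP => I; apply: stable_card_leq.
have [_ _ _ stS] := cover_KS_partition.
rewrite -card_loyal_choice.
exact: (@leq_bigmax_cond _ _ (fun I : {set V} => #|I|)).
Qed.

Lemma cover_mem_card_leq A : A \in C -> #|A| <= #|K|.+1.
Proof.
move=> AC; pose B : {A : {set V} | A \in C} := Sub A AC.
have sub : A \subset s B |: K.
  apply/subsetP => v vA; rewrite in_setU1 in_setC orbC; have [/imsetP[D _ vD]|//] := boolP (v \in S).
  by rewrite vD (_ : D = B) ?eqxx //; apply/esym/val_inj/mem_loyal; rewrite //= -vD.
apply: leq_trans (subset_leq_card sub) _.
by rewrite cardsU1; case: (_ \notin _).
Qed.

Lemma clique_sub_cover (Q : {set V}) :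
  clique G Q -> Q \subset K \/ exists2 A, A \in C & Q \subset A.
Proof.
move=> /forall_inP clQ; have [dQS|] := boolP [disjoint Q & S].
  by left; rewrite -disjoints_subset.
case/pred0Pn => x /= /andP[xQ /imsetP[A _ xA]]; right; exists (val A); first exact: valP.
apply/subsetP => v vQ; have [->|neq_vx] := eqVneq v x; first by rewrite xA; case: (loyal_s A).
apply: loyal_neighbour; rewrite -xA.
by have /forall_inP/(_ v vQ) := clQ x xQ; rewrite eq_sym neq_vx.
Qed.

(** Any balanced KS-partition, not just the one into [K] and [S], has a stable part of size [#|C|],
    hence a clique part of size [#|V| - #|C|]; an unbalancing set is a clique with one vertex
    more. *)
Lemma unbalancing_set_no_balanced_KS :
  has_unbalancing_set C -> ~ has_balanced_KS_partition G.
Proof.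
case=> A AC cardA [K' [S' [/KS_partition_card cKS cK' cS']]].
have := clique_leq_number (cover_mem_clique AC).
rewrite cardA -cK' -cKS cS' cover_independence_number addnK addn1.
by rewrite ltnn.
Qed.

Lemma no_unbalancing_set_balanced_KS :
  ~ has_unbalancing_set C -> has_balanced_KS_partition G.
Proof.
move=> noU; exists K, S; have KS := cover_KS_partition; have [_ _ clK _] := KS.
split=> //; last by rewrite cover_independence_number card_loyal_choice.
apply/eqP; rewrite eqn_leq clique_leq_number //=.
apply/bigmax_leqP => Q /clique_sub_cover[/subset_leq_card //|[A AC QA]].
apply: leq_trans (subset_leq_card QA) _.
(* Only the extreme case [#|A| = #|K| + 1] could exceed the bound, and such an [A] is
   unbalancing. *)
have := cover_mem_card_leq AC; rewrite leq_eqVlt => /orP[/eqP cA|//].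
by case: noU; exists A; rewrite // -card_disloyal addn1.
Qed.

End CoverGraphTheory.

Theorem theorem2p7 (V : finType) (C : {set {set V}})
    (s : {A : {set V} | A \in C} -> V) :
  minimal_set_cover C ->
  (forall A : {A : {set V} | A \in C}, loyal C (val A) (s A)) ->
  let S : {set V} := [set s A | A : {A : {set V} | A \in C}] in
  let K : {set V} := ~: S in
  let G : sgraph V := cover_graph C K in
  [/\ split_graph G,
      unbalanced_split_graph G <-> unbalanced_cover C
    & balanced_split_graph G <-> balanced_cover C].
Proof.
move=> minC ls S K G; have [covC _] := minC.
have splitG : split_graph G by exists K, S; apply: cover_KS_partition.
have U_nB : has_unbalancing_set C -> ~ has_balanced_KS_partition G.
  exact: unbalancing_set_no_balanced_KS.
have nU_B : ~ has_unbalancing_set C -> has_balanced_KS_partition G.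
  exact: no_unbalancing_set_balanced_KS.
split=> //; split=> -[_ H]; split=> //.
(* An unbalancing set must be produced from a negation; its existence is decidable since [V] is
   finite, so the boolean form is split on. *)
- have [/exists_inP[A AC /eqP cA]|noU] :=
    boolP [exists A in C, #|A| == #|V| - #|C| + 1]; first by exists A.
  case: H; apply: nU_B => -[A AC cA]; case/exists_inP: noU.
  by exists A; rewrite ?cA.
- exact: U_nB.
- by move=> /U_nB.
- exact: nU_B.
Qed.
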